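(* Let $G$ be an infinite group and let $A$ be a finite-dimensional vector space over a field $K$. Let $\Sigma \subset A^G$ be a topologically mixing linear-sofic subshift (e.g., $\Sigma = A^G$) and let $\tau \colon \Sigma \to \Sigma$ be a linear cellular automaton, with limit set $\Omega(\tau) = \bigcap_{n \geq 1} \tau^n(\Sigma)$. Then the following conditions are equivalent: (a) $\tau$ is nilpotent; (b) $\tau$ is pointwise nilpotent; (c) there exists $n_0 \in \mathbb{N}$ such that $\tau^{n_0}(\Sigma)$ is finite-dimensional; (d) $\Omega(\tau)$ is finite-dimensional; (e) $\Omega(\tau) = \{0\}$.
   Context: For a $K$-vector space $A$, $A^G$ is the $K$-vector space of all maps $x \colon G \to A$, equipped with the prodiscrete topology (product topology with each factor $A$ discrete) and with the shift action $(gx)(h) = x(g^{-1}h)$. A linear subshift of $A^G$ is a closed $G$-invariant vector subspace of $A^G$. It is of finite type (a linear SFT) if it equals $\{x \in A^G : (g^{-1}x)|_D \in P \text{ for all } g \in G\}$ for some finite $D \subset G$ and some $P \subset A^D$. For $K$-vector spaces $A, B$, a linear cellular automaton $B^G \to A^G$ is a map $\tilde\tau$ for which there exist a finite subset $M \subset G$ and a $K$-linear map $\mu \colon B^M \to A$ with $\tilde\tau(x)(g) = \mu((g^{-1}x)|_M)$ for all $x \in B^G$, $g \in G$. A linear cellular automaton $\tau \colon \Sigma \to \Sigma$ is a map that is the restriction of a linear cellular automaton $A^G \to A^G$. A linear subshift $\Sigma \subset A^G$ is linear-sofic if there exist a $K$-vector space $B$, a linear SFT $\Sigma' \subset B^G$,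 and a linear cellular automaton $\sigma \colon B^G \to A^G$ with $\sigma(\Sigma') = \Sigma$. The subshift $\Sigma$ is topologically mixing if for any two nonempty open subsets $U, V \subset \Sigma$ there exists a finite subset $F \subset G$ such that $U \cap gV \neq \varnothing$ for all $g \in G \setminus F$. A map $f \colon X \to X$ is nilpotent if there exist a constant map $c \colon X \to X$ and an integer $n_0 \geq 1$ such that $f^{n_0} = c$ and hence $f^n = c$ for all $n \geq n_0$ (for linear $f$ this means $f^{n_0} = 0$ for some $n_0 \ge 1$). It is pointwise nilpotent if there exists $x_0 \in X$ such that for each $x \in X$ there is an integer $n_x \geq 1$ with $f^n(x) = x_0$ for all $n \geq n_x$. $\mathbb{N}$ denotes the non-negative integers. *)

(* Defs.v *)
From HB Require Import structures.
From mathcomp Require Export all_boot all_order all_algebra.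
From mathcomp Require Export monoid.
From mathcomp Require Export all_classical.
From mathcomp Require Export topology.

Set Implicit Arguments.
Unset Strict Implicit.
Unset Printing Implicit Defensive.

Import GRing.Theory.

Local Open Scope classical_set_scope.
Local Open Scope ring_scope.

(* [G -> A] carries the library's pointwise vector space structure; topological
   notions on it are always taken at the convertible type [prodiscrete G A]. *)
Notation prodiscrete G A := {ptws G -> discrete_topology A}.

Definition shift (G : groupType) (A : Type) (g : G) (x : G -> A) : G -> A :=
  fun h => x (g^-1 * h)%g.

Definition vector_subspace (K : fieldType) (V : lmodType K) (S : set V) : Prop :=
  S 0 /\ forall (a : K) (x y : V), S x -> S y -> S (a *: x + y).

Definition finite_dimensional (K : fieldType) (V : lmodType K) (S : set V) : Prop :=
  exists (d : nat) (e : 'I_d -> V),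
    S = [set x | exists c : 'I_d -> K, x = \sum_(i < d) c i *: e i].

Definition linear_subshift (K : fieldType) (G : groupType) (A : lmodType K)
    (S : set (G -> A)) : Prop :=
  [/\ closed (S : set (prodiscrete G A)),
      forall (g : G) (x : G -> A), S x -> S (shift g x)
    & vector_subspace S].

Definition linear_SFT (K : fieldType) (G : groupType) (A : lmodType K)
    (S : set (G -> A)) : Prop :=
  linear_subshift S /\
  exists (D : set G) (P : set (D -> A)),
    finite_set D /\
    S = [set x | forall g : G, P (sigL D (shift g^-1%g x))].

Definition linear_CA (K : fieldType) (G : groupType) (B A : lmodType K)
    (t : (G -> B) -> (G -> A)) : Prop :=
  exists (M : set G) (mu : {linear (M -> B) -> A}),
    finite_set M /\
    forall (x : G -> B) (g : G), t x g = mu (sigL M (shift g^-1%g x)).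

Definition linear_CA_on (K : fieldType) (G : groupType) (A : lmodType K)
    (S : set (G -> A)) (tau : S -> S) : Prop :=
  exists2 t : (G -> A) -> (G -> A),
    linear_CA t & forall x : S, set_val (tau x) = t (set_val x).

(* The alphabet [B] is an arbitrary, possibly infinite-dimensional, space. *)
Definition linear_sofic (K : fieldType) (G : groupType) (A : lmodType K)
    (S : set (G -> A)) : Prop :=
  linear_subshift S /\
  exists (B : lmodType K) (S' : set (G -> B)) (s : (G -> B) -> (G -> A)),
    [/\ linear_SFT S', linear_CA s & s @` S' = S].

Definition relatively_open (T : topologicalType) (S U : set T) : Prop :=
  exists2 W : set T, open W & U = W `&` S.

Definition topologically_mixing (G : groupType) (A : choiceType)
    (S : set (G -> A)) : Prop :=
  forall U V : set (prodiscrete G A),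
    relatively_open (S : set (prodiscrete G A)) U ->
    relatively_open (S : set (prodiscrete G A)) V ->
    U !=set0 -> V !=set0 ->
    exists2 F : set G, finite_set F &
      forall g : G, ~ F g -> U `&` (shift g @` V) !=set0.

Definition nilpotent_map (X : Type) (f : X -> X) : Prop :=
  exists (c : X) (n0 : nat), (1 <= n0)%N /\ forall x : X, iter n0 f x = c.

Definition pointwise_nilpotent_map (X : Type) (f : X -> X) : Prop :=
  exists x0 : X, forall x : X, exists2 nx : nat, (1 <= nx)%N &
    forall n : nat, (nx <= n)%N -> iter n f x = x0.

(* [tau^n(S)], viewed inside the ambient type. *)
Definition iter_image (T : Type) (S : set T) (tau : S -> S) (n : nat) : set T :=
  [set set_val (iter n tau x) | x in [set: S]].

Definition limit_set (T : Type) (S : set T) (tau : S -> S) : set T :=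
  \bigcap_(n in [set n : nat | (1 <= n)%N]) iter_image tau n.

(* Main.v *)
Require Import Defs.

(**
  Since [A] is finite-dimensional, [A^G] is linearly compact: a directed family
  of nonempty closed affine subspaces has a common point.  Hence the images
  [X n = t^n(Sigma)] are closed, and on every finite window the patterns of
  [X n] are, for [n] large, exactly those of [Omega].  With [Omega = 0] and a
  one-point window this gives nilpotency; a Baire category argument turns
  pointwise nilpotency into finite-dimensionality of some [X n].

  Suppose [Omega] is finite-dimensional and nonzero, and let [E] be a finite
  window determining its elements.  By soficity, [Omega] is stable under
  restriction to cosets of the subgroup [H] generated by the memory and
  defining windows, so every coset of [H] meets [E] (otherwise [Omega] would
  contain a nonzero configuration vanishing on [E]).  Elements of [Omega] can
  then be recognized on the finite windows [g E'], with [E'] made of [E] and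
  its translates by generators: [X n = Omega] as soon as the two agree on [E'].
  Mixing of [Sigma] now produces a point of [Omega] equal to a given [w] on [E]
  and to [0] on some translate [g E], which forces [w = 0].
*)

Set Implicit Arguments.
Unset Strict Implicit.
Unset Printing Implicit Defensive.

Import GRing.Theory.

Local Open Scope classical_set_scope.
Local Open Scope ring_scope.

(** * Finite windows and the prodiscrete topology *)

Definition cylinder (G : eqType) (A : Type) (E : seq G) (x : G -> A) :
  set (G -> A) := [set y : G -> A | {in E, y =1 x}].

(** Closedness in terms of finite windows, the only form that the compactness arguments use. *)
Definition window_closed (G : eqType) (A : Type) (S : set (G -> A)) : Prop :=
  forall x, (forall E : seq G, S `&` cylinder E x !=set0) -> S x.

Definition affine_set (K : fieldType) (V : lmodType K) (S : set V) : Prop :=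
  S !=set0 /\
  forall (a : K) (x y z : V), S x -> S y -> S z -> S (a *: (x - y) + z).

Definition directed_family (I T : Type) (F : I -> set T) : Prop :=
  forall i j, exists k, F k `<=` F i `&` F j.

(** The cylinders around [x] generate a filter converging to [x], so each neighbourhood of [x]
    contains a cylinder and hence meets [S]. *)
Lemma prodiscrete_closed_window (G A : choiceType) (S : set (G -> A)) :
  closed (S : set (prodiscrete G A)) -> window_closed S.
Proof.
move=> cS x xS; apply: cS => B Bx.
pose F : set_system (prodiscrete G A) :=
  [set B | exists E : seq G, cylinder E x `<=` B].
have FF : Filter F.
  split.
  - by exists [::].
  - move=> P Q [E EP] [E' EQ]; exists (E ++ E') => y /= yE; split.
      by apply: EP => g gE; apply: yE; rewrite mem_cat gE.
    by apply: EQ => g gE; apply: yE; rewrite mem_cat gE orbT.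
  - by move=> P Q PQ [E EP]; exists E => y /EP /PQ.
have /(_ B Bx) [E EB] : F --> (x : prodiscrete G A).
  apply/cvg_sup => g U [V] [[W] oW <-] WgV WU; exists [:: g] => y /= yx.
  by apply: WU; rewrite /= yx ?inE.
by have [y [Sy yE]] := xS E; exists y; split=> //; apply: EB.
Qed.

Lemma prodiscrete_cylinder_open (G A : choiceType) (E : seq G) (x : G -> A) :
  open (cylinder E x : set (prodiscrete G A)).
Proof.
elim: E => [|g E IH].
  by rewrite (_ : cylinder _ _ = setT); [exact: openT | apply/seteqP; split].
rewrite (_ : cylinder _ _ =
  (proj g : prodiscrete G A -> discrete_topology A) @^-1` [set x g] `&`
  cylinder E x).
  apply: openI => //; apply: open_comp; last exact: discrete_open.
  by move=> y _; exact: (@proj_continuous G (fun=> discrete_topology A) g y).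
apply/seteqP; split=> y /=.
  move=> yx; split; first by rewrite /proj yx // mem_head.
  by move=> h hE; apply: yx; rewrite inE hE orbT.
by move=> [yg yE] h; rewrite inE => /orP[/eqP->|/yE].
Qed.

(** * Directed affine families in finite dimension *)

(** A subspace [U] of maximal dimension inside [S] is all of [S]: adjoining a vector of [S] outside
    [U] would raise the dimension. *)
Lemma subspace_vspace (K : fieldType) (W : vectType K) (S : set W) :
  vector_subspace S -> exists U : {vspace W}, S = [set` U].
Proof.
move=> [S0 SD].
pose P (n : nat) := `[< exists2 U : {vspace W}, \dim U = n & [set` U] `<=` S >].
have exP : exists n, P n.
  by exists 0%N; apply/asboolP; exists 0%VS; [rewrite dimv0|
    move=> x /=; rewrite memv0 => /eqP->].
have boundP n : P n -> (n <= \dim {:W})%N.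
  by move=> /asboolP [U <- _]; apply: dimvS; exact: subvf.
case: (ex_maxnP exP boundP) => n /asboolP[U dimU US] maxn.
exists U; apply/seteqP; split=> // x Sx /=.
have : P (\dim (<[x]> + U)).
  apply/asboolP; exists (<[x]> + U)%VS => // y /memv_addP[u /vlineP[a ->]].
  by move=> [v vU ->]; apply: SD => //; exact: US.
move/maxn; rewrite -dimU => dle.
have -> : U = (<[x]> + U)%VS by apply/eqP; rewrite eqEdim addvSr.
by apply: (subvP (addvSl _ _)); exact: memv_line.
Qed.

(* The least member is one whose direction space has least dimension. *)
Lemma directed_affine_least (K : fieldType) (W : vectType K) (I : Type)
    (F : I -> set W) (i0 : I) :
  (forall i, affine_set (F i)) -> directed_family F ->
  exists i, forall j, F i `<=` F j.
Proof.
move=> affF dirF.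
have /choice[U UP] i : exists U : {vspace W},
    [set v | exists y z, [/\ F i y, F i z & v = y - z]] = [set` U].
  apply: subspace_vspace; have [[x Fx] Faff] := affF i; split.
    by exists x, x; rewrite subrr.
  move=> a _ _ [y [z [Fy Fz ->]]] [y' [z' [Fy' Fz' ->]]].
  by exists (a *: (y - z) + y'), z'; rewrite addrA; split=> //; exact: Faff.
pose P (n : nat) := `[< exists i, \dim (U i) = n >].
have exP : exists n, P n by exists (\dim (U i0)); apply/asboolP; exists i0.
case: (ex_minnP exP) => n /asboolP[i <-] minn; exists i => j x Fx.
have [k Fk] := dirF i j.
have UE : U k = U i.
  apply/eqP; rewrite eqEdim minn ?andbT; last by apply/asboolP; exists k.
  apply/subvP => v vk; have : [set` U k] v by [].
  rewrite -UP => -[y [z [/Fk[Fy _] /Fk[Fz _] ->]]].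
  suff : [set` U i] (y - z) by [].
  by rewrite -UP; exists y, z.
have [[y Fy] Faff] := affF k; have [Fiy _] := Fk _ Fy.
have : [set` U k] (x - y) by rewrite UE -UP; exists x, y.
rewrite -UP => -[p [q [Fp Fq xy]]].
suff /Fk[] : F k x by [].
by rewrite -(subrK y x) xy -[p - q]scale1r; exact: Faff.
Qed.

(** * Linear compactness of configuration spaces *)

Section LinearCompactness.
Variables (K : fieldType) (G : choiceType) (A : vectType K) (I : Type).
Variable F : I -> set (G -> A).
Hypothesis affF : forall i, affine_set (F i).
Hypothesis closedF : forall i, window_closed (F i).
Hypothesis dirF : directed_family F.

(* Tychonoff-style: [R] is the graph of a partial configuration all of whose
   finite parts are compatible with every [F i]; by Zorn take it maximal. *)
Lemma linear_compactness : I -> exists x, forall i, F i x.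
Proof.
move=> i0.
pose fits (l : seq (G * A)) (y : G -> A) := forall p, p \in l -> y p.1 = p.2.
pose P (R : set (G * A)) := forall (l : seq (G * A)) i,
  (forall p, p \in l -> R p) -> exists2 y, F i y & fits l y.
have fits_sub l l' y : {subset l' <= l} -> fits l y -> fits l' y.
  by move=> sub yl p /sub /yl.
have [R [PR Rmax]] : exists R, P R /\ forall R', R `<` R' -> ~ P R'.
  apply: Zorn_bigcup => Q QP Qtot l i lQ.
  have [->|[R [QR lR]]] : l = [::] \/ exists R, Q R /\ forall p, p \in l -> R p.
  - elim: l lQ => [|p l IH] lQ; [by left|right].
    have [R QR Rp] := lQ p (mem_head _ _).
    have [|->|[R' [QR' lR']]] := IH.
    + by move=> q ql; apply: lQ; rewrite inE ql orbT.
    + by exists R; split=> // q; rewrite inE => /eqP->.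
    + have [RR'|R'R] := Qtot _ _ QR QR'.
        exists R'; split=> // q; rewrite inE => /orP[/eqP->|/lR' //].
        exact: RR'.
      by exists R; split=> // q; rewrite inE => /orP[/eqP->|/lR' /R'R].
  - by have [[y Fy] _] := affF i; exists y.
  - exact: QP lR.
have Rtotal g : exists a, R (g, a).
  (* The values at [g] compatible with some [F i] and finitely many constraints from [R] form a
     directed family of affine subsets of [A]; a point of its least member can be added to [R]. *)
  pose J := (I * {l : seq (G * A) | forall p, p \in l -> R p})%type.
  pose Fg (j : J) : set A :=
    [set y g | y in [set y | F j.1 y /\ fits (sval j.2) y]].
  have nilR : forall p, p \in ([::] : seq (G * A)) -> R p by [].
  have [||j jmin] := @directed_affine_least K A J Fg (i0, exist _ [::] nilR).
  - move=> [i [l lR]]; split.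
      by have [y Fy yl] := PR l i lR; exists (y g), y.
    move=> a _ _ _ [x [Fx xl] <-] [y [Fy yl] <-] [z [Fz zl] <-] /=.
    exists (a *: (x - y) + z) => //; split; first by apply: (affF i).2.
    move=> p pl; have := (xl p pl, yl p pl, zl p pl).
    rewrite /= /GRing.scale /GRing.add /= /GRing.opp /= => -[[-> ->] ->].
    by rewrite subrr scaler0 add0r.
  - move=> [i [l lR]] [i' [l' l'R]].
    have [k Fk] := dirF i i'.
    have catR : forall p, p \in l ++ l' -> R p.
      by move=> p; rewrite mem_cat => /orP[/lR|/l'R].
    exists (k, exist _ (l ++ l') catR) => _ [y [/= /Fk[Fy Fy'] yl] <-].
    split; exists y => //=; split=> //; apply: fits_sub yl => p pl.
      by rewrite mem_cat pl.
    by rewrite mem_cat pl orbT.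
  have [a Fja] : Fg j !=set0.
    case: j {jmin} => i [l lR].
    by have [y Fy yl] := PR l i lR; exists (y g), y.
  exists a; apply: contrapT => Ra.
  have : R `<` (R `|` [set (g, a)]).
    by split=> [p Rp|/(_ (g, a)) sub]; [left | apply: Ra; apply: sub; right].
  move/Rmax; apply => l i lR.
  (* Constraints other than [(g, a)] come from [R]; since [a] lies in the least member, they can be
     met together with value [a] at [g]. *)
  have l'R : forall p, p \in [seq p <- l | p != (g, a)] -> R p.
    by move=> p; rewrite mem_filter => /andP[/eqP pga /lR [|]].
  have [y [/= Fy yl] yga] := jmin (i, exist _ _ l'R) _ Fja.
  exists y => // p pl; have [->//|pga] := eqVneq p (g, a).
  by apply: yl; rewrite mem_filter pga.
have [x xR] := choice Rtotal; exists x => i; apply: closedF => E.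
have [|y Fy yE] := PR [seq (g, x g) | g <- E] i.
  by move=> _ /mapP[g _ ->].
exists y; split=> // g gE; apply: (yE (g, x g)).
by apply: map_f.
Qed.

End LinearCompactness.

(** * Linear cellular automata and masks *)

Lemma linear_fun0 (K : fieldType) (V W : lmodType K) (f : V -> W) :
  linear f -> f 0 = 0.
Proof.
by move=> /(_ (-1) 0 0); rewrite scaler0 addr0 scaleN1r addNr.
Qed.

Lemma subspace_affine (K : fieldType) (V : lmodType K) (S : set V) :
  vector_subspace S -> affine_set S.
Proof.
move=> [S0 SD]; split; first by exists 0.
move=> a x y z Sx Sy Sz; apply: (SD) => //.
by rewrite addrC -scaleN1r; exact: SD.
Qed.

Lemma subspace_image (K : fieldType) (V W : lmodType K) (f : V -> W)
    (S : set V) : linear f -> vector_subspace S -> vector_subspace (f @` S).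
Proof.
move=> flin [S0 SD]; split.
  by exists 0; rewrite ?linear_fun0.
move=> a _ _ [x Sx <-] [y Sy <-]; exists (a *: x + y); last by rewrite flin.
exact: SD.
Qed.

(* Linear cellular automata with memory set [M], without their local rule. *)
Definition lca (K : fieldType) (G : groupType) (B A : lmodType K) (M : seq G)
    (t : (G -> B) -> (G -> A)) : Prop :=
  [/\ linear t,
      forall g x, t (shift g x) = shift g (t x)
    & forall g x y, (forall m, m \in M -> x (g * m)%g = y (g * m)%g) ->
        t x g = t y g].

Lemma linear_CA_lca (K : fieldType) (G : groupType) (B A : lmodType K)
    (t : (G -> B) -> (G -> A)) : linear_CA t -> exists M, lca M t.
Proof.
move=> [D [mu [/finite_seqP[M DM] tE]]].
have {}DM g : D g -> g \in M by rewrite DM.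
exists M; split.
- move=> a x y; apply/funext => g.
  by transitivity (a *: t x g + t y g); rewrite // !tE -[RHS]linearP.
- move=> g x; apply/funext => h; rewrite tE /shift tE; congr (mu _).
  by apply/funext => m; rewrite /sigL /= /shift !invgK mulgA.
- move=> g x y xy; rewrite !tE; congr (mu _); apply/funext => m.
  rewrite /sigL /= /shift invgK; apply: xy.
  by apply: DM; exact: set_mem (valP m).
Qed.

Lemma lca_id (K : fieldType) (G : groupType) (A : lmodType K) :
  lca [:: 1%g] (@id (G -> A)).
Proof. by split=> // g x y /(_ 1%g (mem_head _ _)); rewrite mulg1. Qed.

Lemma lca_iter (K : fieldType) (G : groupType) (A : lmodType K) (M : seq G)
    (t : (G -> A) -> (G -> A)) n : lca M t -> exists M', lca M' (iter n t).
Proof.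
move=> [tlin tsh tloc]; elim: n => [|n [M' [ilin ish iloc]]].
  by exists [:: 1%g]; exact: lca_id.
exists [seq (m * m')%g | m <- M, m' <- M']; split.
- by move=> a x y; rewrite !iterS ilin tlin.
- by move=> g x; rewrite !iterS ish tsh.
- move=> g x y xy; rewrite !iterS; apply: tloc => m mM.
  apply: iloc => m' m'M; rewrite -mulgA; apply: xy.
  by apply/allpairsP; exists (m, m').
Qed.

(** These sets are the unions of left cosets of the subgroup generated by [M]. *)
Definition saturated (G : groupType) (M : seq G) (C : set G) : Prop :=
  forall g m, m \in M -> C (g * m)%g <-> C g.

Definition mask (G : Type) (A : zmodType) (C : set G) (x : G -> A) : G -> A :=
  fun g => if `[< C g >] then x g else 0.

Lemma lca_eq0 (K : fieldType) (G : groupType) (B A : lmodType K) (M : seq G)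
    (t : (G -> B) -> (G -> A)) : lca M t -> t 0 = 0.
Proof. by move=> [tlin _ _]; exact: linear_fun0. Qed.

(** At a cell of [C] the automaton reads only cells of [C]; at any other cell it reads only
    zeros. *)
Lemma lca_mask (K : fieldType) (G : groupType) (B A : lmodType K) (M : seq G)
    (t : (G -> B) -> (G -> A)) (C : set G) x :
  lca M t -> saturated M C -> t (mask C x) = mask C (t x).
Proof.
move=> tM satC; have [_ _ tloc] := tM; apply/funext => g; rewrite {2}/mask.
case: asboolP => Cg.
  apply: tloc => m mM; rewrite /mask asboolT //.
  by apply/(satC g m mM).
transitivity (t 0 g); last by rewrite (lca_eq0 tM).
apply: tloc => m mM; rewrite /mask asboolF //.
by move/(satC g m mM).
Qed.

(** * Fibers over windows and closed images *)

Section Fiber.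
Variables (K : fieldType) (G : groupType) (A B : vectType K) (M : seq G).
Variables (f : (G -> B) -> (G -> A)) (S : set (G -> B)).
Hypothesis fM : lca M f.

Definition fiber (E : seq G) (y : G -> A) : set (G -> B) :=
  S `&` f @^-1` cylinder E y.

Lemma fiber_affine E y : affine_set S -> fiber E y !=set0 ->
  affine_set (fiber E y).
Proof.
move=> [_ Saff] ne; split=> // a x1 x2 x3 [S1 f1] [S2 f2] [S3 f3].
split; first exact: Saff.
have [flin _ _] := fM; move=> g gE /=.
have -> : x1 - x2 = -1 *: x2 + x1 by rewrite scaleN1r addrC.
rewrite !flin; transitivity (a *: (-1 *: f x2 g + f x1 g) + f x3 g) => //.
rewrite (f1 g gE : _ = _) (f2 g gE : _ = _) (f3 g gE : _ = _).
by rewrite scaleN1r addNr scaler0 add0r.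
Qed.

Lemma fiber_closed E y : window_closed S -> window_closed (fiber E y).
Proof.
move=> Scl x xcl; split.
  by apply: Scl => E'; have [z [[Sz _] zx]] := xcl E'; exists z.
have [_ _ floc] := fM; move=> g gE.
have [z [[_ fz] zx]] := xcl [seq (g * m)%g | m <- M].
rewrite -(fz g gE); apply: floc => m mM; apply/esym/zx.
exact: map_f.
Qed.

Lemma fiber_cat E E' y : fiber (E ++ E') y `<=` fiber E y `&` fiber E' y.
Proof.
move=> x [Sx fx]; split; split=> // g gE; apply: fx.
  by rewrite mem_cat gE.
by rewrite mem_cat gE orbT.
Qed.

(** For [y] in the closure of the image, the fibers over finite windows are nonempty, closed and
    affine; a common point is a preimage of [y]. *)
Lemma lca_image_closed : affine_set S -> window_closed S ->
  window_closed (f @` S).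
Proof.
move=> Saff Scl y ycl.
have [||||x xy] := @linear_compactness K G B (seq G) (fiber^~ y).
- move=> E; apply: fiber_affine => //.
  by have [_ [[x Sx <-] xy]] := ycl E; exists x.
- by move=> E; exact: fiber_closed.
- by move=> E E'; exists (E ++ E'); exact: fiber_cat.
- exact: [::].
- exists x; first by have [] := xy [::].
  by apply/funext => g; have [_] := xy [:: g]; apply; rewrite mem_head.
Qed.

End Fiber.

(** * Finite-dimensional subspaces *)

Lemma linear_fun_sum (K : fieldType) (V W : lmodType K) (f : V -> W) d
    (c : 'I_d -> K) (e : 'I_d -> V) :
  linear f -> f (\sum_(i < d) c i *: e i) = \sum_(i < d) c i *: f (e i).
Proof.
move=> flin; elim/big_rec2: _ => [|i u v _ <-]; first exact: linear_fun0.
exact: flin.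
Qed.

Lemma subspace_sum (K : fieldType) (V : lmodType K) (S : set V) d
    (c : 'I_d -> K) (e : 'I_d -> V) :
  vector_subspace S -> (forall i, S (e i)) -> S (\sum_(i < d) c i *: e i).
Proof.
move=> [S0 SD] Se; elim/big_ind: _ => //.
  by move=> x y Sx Sy; rewrite -[x]scale1r; exact: SD.
by move=> i _; rewrite -[_ *: _]addr0; exact: SD.
Qed.

Lemma finite_dimensional_factor (K : fieldType) (V V' : lmodType K)
    (W : vectType K) (r : V -> W) (f : V -> V') (S : set V) :
  linear r -> linear f -> vector_subspace S ->
  (forall x, S x -> r x = 0 -> f x = 0) -> finite_dimensional (f @` S).
Proof.
move=> rlin flin Ssub rf0.
have [U SU] := subspace_vspace (subspace_image rlin Ssub).
have /choice[y yP] (i : 'I_(\dim U)) : exists y, S y /\ r y = (vbasis U)`_i.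
  have : [set` U] (vbasis U)`_i.
    by apply: vbasis_mem; rewrite mem_nth ?size_tuple.
  by rewrite -SU => -[y Sy ry]; exists y.
exists (\dim U), (f \o y); apply/seteqP; split=> x /=.
  move=> [z Sz <-].
  have rz : r z \in U by have : (r @` S) (r z) by [exists z]; rewrite SU.
  exists (fun i => coord (vbasis U) i (r z)).
  set c := fun i => _; rewrite -(linear_fun_sum _ _ flin).
  have [S0 SD] := Ssub; apply/eqP; rewrite -subr_eq0 addrC -scaleN1r -flin.
  apply/eqP; apply: rf0.
    by apply: SD => //; apply: subspace_sum => // i; case: (yP i).
  rewrite rlin (linear_fun_sum _ _ rlin) {2}(coord_vbasis rz) scaleN1r.
  apply/eqP; rewrite addrC subr_eq0; apply/eqP; apply: eq_bigr => i _.
  by rewrite (yP i).2.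
move=> [c ->]; apply: (subspace_sum _ (subspace_image flin Ssub)).
by move=> i; exists (y i) => //; case: (yP i).
Qed.

Lemma combination_linear (K : fieldType) (V : lmodType K) d (e : 'I_d -> V) :
  linear (fun c : 'rV[K]_d => \sum_(i < d) c 0 i *: e i).
Proof.
move=> a x y; rewrite scaler_sumr -big_split; apply: eq_bigr => i _ /=.
by rewrite !mxE scalerDl scalerA.
Qed.

Lemma finite_dimensional_combination (K : fieldType) (V : lmodType K)
    (S : set V) : finite_dimensional S ->
  exists d (e : 'I_d -> V),
    S = range (fun c : 'rV[K]_d => \sum_(i < d) c 0 i *: e i).
Proof.
move=> [d [e ->]]; exists d, e; apply/seteqP; split=> x /=.
  move=> [c ->]; exists (\row_i c i) => //.
  by apply: eq_bigr => i _; rewrite mxE.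
by move=> [c _ <-]; exists (c 0).
Qed.

Lemma finite_dimensional_subspace (K : fieldType) (V : lmodType K)
    (S T : set V) : finite_dimensional S -> vector_subspace T -> T `<=` S ->
  finite_dimensional T.
Proof.
move=> /finite_dimensional_combination[d [e ->]] [T0 TD].
set f := fun c => _; have flin : linear f := combination_linear e.
move=> TS; have -> : T = f @` (f @^-1` T).
  apply/seteqP; split=> [x Tx|_ [c fc <-] //].
  by have [c _ cx] := TS _ Tx; exists c => //=; rewrite /preimage /= cx.
apply: (@finite_dimensional_factor K _ _ 'rV[K]_d id f) => //.
- split=> [|a x y Tx Ty]; rewrite /preimage /= ?linear_fun0 // flin.
  exact: TD.
- by move=> x _ ->; exact: linear_fun0.
Qed.

(** The coefficient vectors whose combination vanishes on [E] form a directed family of subspaces; a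
    window with the least one forces vanishing at every cell. *)
Lemma finite_dimensional_window (K : fieldType) (G : choiceType)
    (A : lmodType K) (S : set (G -> A)) : finite_dimensional S ->
  exists E : seq G, forall x, S x -> {in E, x =1 0} -> x = 0.
Proof.
move=> /finite_dimensional_combination[d [e ->]].
set f := fun c : 'rV[K]_d => _; have flin : linear f := combination_linear e.
pose F (E : seq G) : set 'rV[K]_d := f @^-1` cylinder E 0.
have [||E Emin] := @directed_affine_least K 'rV[K]_d (seq G) F [::].
- move=> E; apply: subspace_affine; split=> [|a x y Fx Fy] g gE.
    by rewrite linear_fun0.
  rewrite flin; transitivity (a *: f x g + f y g) => //.
  by rewrite (Fx g gE : _ = _) (Fy g gE : _ = _) scaler0 addr0.
- move=> E E'; exists (E ++ E') => c Fc; split=> g gE; apply: Fc.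
    by rewrite mem_cat gE.
  by rewrite mem_cat gE orbT.
exists E => _ [c _ <-] fc; apply/funext => g.
by apply: (Emin [:: g] c fc); rewrite mem_head.
Qed.

(** * Window patterns, open preimages and sofic subshifts *)

Definition window_restr (G : Type) (A : Type) (E : seq G) (x : G -> A) :
  {ffun 'I_(size E) -> A} := [ffun i => x (tnth (in_tuple E) i)].

Lemma window_restr_linear (K : fieldType) (G : Type) (A : vectType K)
    (E : seq G) : linear (@window_restr G A E).
Proof. by move=> a x y; apply/ffunP => i; rewrite !ffunE. Qed.

Lemma window_restrP (G : eqType) (A : Type) (E : seq G) (x y : G -> A) :
  window_restr E x = window_restr E y <-> {in E, x =1 y}.
Proof.
split=> [/ffunP xy g gE|xy].
  have [i ->] : exists i, g = tnth (in_tuple E) i by apply/tnthP.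
  by have := xy i; rewrite !ffunE.
by apply/ffunP => i; rewrite !ffunE; apply: xy; exact: mem_tnth.
Qed.

Lemma lca_preimage_open (K : fieldType) (G : groupType) (B A : lmodType K)
    (M : seq G) (f : (G -> B) -> (G -> A)) (E : seq G) (y : G -> A) :
  lca M f -> open (f @^-1` cylinder E y : set (prodiscrete G B)).
Proof.
move=> [_ _ floc]; rewrite openE => x fx.
pose E' := [seq (g * m)%g | g <- E, m <- M].
have := prodiscrete_cylinder_open E' x; rewrite openE => /(_ x) oE'.
apply: filterS (oE' _) => [z zx g gE|//].
rewrite -(fx g gE); apply: floc => m mM; apply: zx.
by apply/allpairsP; exists (g, m).
Qed.

(* A finite-type condition and a memory set only see one coset of the subgroup
   they generate, so patching with 0 off a union of cosets is harmless. *)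
Lemma sofic_mask (K : fieldType) (G : groupType) (A : lmodType K)
    (S : set (G -> A)) : linear_sofic S ->
  exists M : seq G, forall C, saturated M C -> forall x, S x -> S (mask C x).
Proof.
move=> [_ [B [S' [s [S'sft sCA <-]]]]].
have [[_ _ [S'0 _]] [D [P [/finite_seqP[D' DD'] S'E]]]] := S'sft.
have {}DD' g : D g -> g \in D' by rewrite DD'.
have [M sM] := linear_CA_lca sCA; exists (D' ++ M) => C satC _ [x S'x <-].
exists (mask C x); last first.
  by apply: (lca_mask _ sM) => g m mM; apply: satC; rewrite mem_cat mM orbT.
rewrite S'E in S'0 S'x *; move=> g; have [Cg|nCg] := pselect (C g).
  rewrite (_ : sigL _ _ = sigL D (shift g^-1%g x)); first exact: S'x.
  apply/funext => d; rewrite /sigL /= /shift /mask asboolT //.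
  rewrite invgK; apply/satC => //.
  by rewrite mem_cat DD' //; exact: set_mem (valP d).
rewrite (_ : sigL _ _ = sigL D (shift g^-1%g 0)); first exact: S'0.
apply/funext => d; rewrite /sigL /= /shift /mask asboolF // invgK => Cgd.
apply: nCg; move: Cgd; apply: (satC _ _ _).1.
by rewrite mem_cat DD' //; exact: set_mem (valP d).
Qed.

(** * Images of the iterates and the limit set *)

Section LimitSet.
Variables (K : fieldType) (G : groupType) (A : vectType K).
Variables (Sigma : set (G -> A)) (t : (G -> A) -> (G -> A)) (M : seq G).
Hypothesis Sclosed : window_closed Sigma.
Hypothesis Sshift : forall g x, Sigma x -> Sigma (shift g x).
Hypothesis Ssub : vector_subspace Sigma.
Hypothesis tM : lca M t.
Hypothesis tS : forall x, Sigma x -> Sigma (t x).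

Definition iterate (n : nat) : set (G -> A) := iter n t @` Sigma.
(** The intersection starts at [n = 0], which changes nothing since the images decrease. *)
Definition Omega : set (G -> A) := [set x | forall n, iterate n x].

Lemma iter_stable n x : Sigma x -> Sigma (iter n t x).
Proof. by move=> Sx; elim: n => //= n; exact: tS. Qed.

Lemma iterate_subspace n : vector_subspace (iterate n).
Proof. by have [M' [ilin _ _]] := lca_iter n tM; exact: subspace_image. Qed.

Lemma iterate_closed n : window_closed (iterate n).
Proof.
have [M' iM] := lca_iter n tM.
by apply: (lca_image_closed iM) => //; exact: subspace_affine.
Qed.

Lemma iterate_decr m n : (m <= n)%N -> iterate n `<=` iterate m.
Proof.
move=> /subnKC <- _ [x Sx <-]; rewrite iterD.
by exists (iter (n - m) t x) => //; exact: iter_stable.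
Qed.

Lemma iterate_shift n g x : iterate n x -> iterate n (shift g x).
Proof.
have [M' [_ ish _]] := lca_iter n tM.
by move=> [y Sy <-]; exists (shift g y); rewrite ?ish //; exact: Sshift.
Qed.

Lemma Omega_subspace : vector_subspace Omega.
Proof.
split=> [n|a x y Ox Oy n]; first exact: (iterate_subspace n).1.
exact: (iterate_subspace n).2.
Qed.

Lemma Omega_shift g x : Omega x -> Omega (shift g x).
Proof. by move=> Ox n; exact: iterate_shift. Qed.

(* Patterns on a finite window stabilize by dimension, and a pattern occurring
   in every iterate occurs in the limit set by linear compactness. *)
Lemma limit_window (E : seq G) :
  exists n, forall x, iterate n x -> Omega `&` cylinder E x !=set0.
Proof.
have dir m n (F : nat -> set (G -> A)) :
    (forall m n, (m <= n)%N -> F n `<=` F m) ->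
    F (maxn m n) `<=` F m `&` F n.
  by move=> decr x Fx; split; apply: decr Fx; rewrite ?leq_maxl ?leq_maxr.
pose F n := window_restr E @` iterate n.
have [||n nmin] := @directed_affine_least K _ nat F 0%N.
- move=> n; apply: subspace_affine; apply: subspace_image.
    exact: window_restr_linear.
  exact: iterate_subspace.
- move=> m n; exists (maxn m n) => _ [x /(dir _ _ _ iterate_decr)[Xm Xn] <-].
  by split; exists x.
exists n => x Xx.
have [||||w wP] := @linear_compactness K G A nat
  (fun n => fiber id (iterate n) E x).
- move=> m; apply: (fiber_affine (lca_id G A)).
    by apply: subspace_affine; exact: iterate_subspace.
  have [|y Xy /window_restrP yx] := nmin m (window_restr E x).
    by exists x.
  by exists y.
- by move=> m; apply: (fiber_closed (lca_id G A)); exact: iterate_closed.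
- move=> m p; exists (maxn m p) => y [/(dir _ _ _ iterate_decr)[Xm Xp] yx].
  by split.
- exact: 0%N.
by exists w; split=> [m|]; [have [] := wP m | have [] := wP 0%N].
Qed.

(** Some image vanishes at the cell [1], hence everywhere by shift invariance; [n.+1] provides a
    positive exponent. *)
Lemma Omega0_nilpotent : Omega = [set 0] ->
  exists n, forall x, Sigma x -> iter n.+1 t x = 0.
Proof.
move=> O0; have [n nP] := limit_window [:: 1%g]; exists n => x Sx.
apply/funext => g; set y := iter n.+1 t x.
have : iterate n (shift g^-1%g y).
  by apply: (iterate_decr (leqnSn n)); apply: iterate_shift; exists x.
move/nP => [w []]; rewrite O0 => -> /(_ 1%g (mem_head _ _)).
by rewrite /shift invgK mulg1.
Qed.

(* Baire category: the closed subspaces [ker t^n] cover [Sigma], so one of them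
   contains all configurations vanishing on some finite window. *)
Lemma pointwise_nilpotent_finite_dimensional :
  (forall x, Sigma x -> exists n, iter n t x = 0) ->
  exists n, finite_dimensional (iterate n).
Proof.
move=> nilt.
have [[n [E nE]]|nker] := pselect (exists n (E : seq G), forall x,
    Sigma x -> {in E, x =1 0} -> iter n t x = 0).
  exists n; have [M' [ilin _ _]] := lca_iter n tM.
  apply: (@finite_dimensional_factor K _ _ _ (window_restr E)) => //.
    exact: window_restr_linear.
  move=> x Sx; have <- : window_restr E (0 : G -> A) = 0.
    exact: linear_fun0 (@window_restr_linear K G A E).
  by move/window_restrP; exact: nE.
exfalso.
have /choice[next nextP] (p : nat * (Sigma * seq G)) :
    exists q : Sigma * seq G,
      [/\ {subset p.2.2 <= q.2},
          {in p.2.2, set_val q.1 =1 set_val p.2.1}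
        & forall y, Sigma y -> cylinder q.2 (set_val q.1) y ->
            iter p.1 t y <> 0].
  case: p => n [x E] /=; have Sx := set_valP x.
  have [M' [ilin _ iloc]] := lca_iter n tM.
  have [x' [Sx' x'x tx']] : exists x' : G -> A,
      [/\ Sigma x', {in E, x' =1 set_val x} & iter n t x' <> 0].
    have [tx|] := pselect (iter n t (set_val x) = 0); last first.
      by exists (set_val x).
    have [z [Sz zE tz]] : exists z,
        [/\ Sigma z, {in E, z =1 0} & iter n t z <> 0].
      apply: contrapT => nz; apply: nker; exists n, E => z Sz zE.
      by apply: contrapT => tz; apply: nz; exists z.
    (* Adding [z] keeps the pattern on [E] and makes the image under [t^n] nonzero. *)
    exists (1 *: z + set_val x); split; first exact: Ssub.2.
      move=> g gE; transitivity (1 *: z g + set_val x g) => //.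
      by rewrite zE // scaler0 add0r.
    by rewrite ilin tx addr0 scale1r.
  have [g tg] : exists g, iter n t x' g <> 0.
    by apply: contrapT => H; apply: tx'; apply/funext => g;
       apply: contrapT => tg; apply: H; exists g.
  (* On the enlarged window, the pattern of [x'] determines the nonzero value of [t^n] at [g]. *)
  exists (SigSub (mem_set Sx'), E ++ [seq (g * m)%g | m <- M']); split=> //=.
    by move=> h hE; rewrite mem_cat hE.
  move=> y Sy yx' ty; apply: tg; rewrite -(_ : iter n t y g = iter n t x' g).
    by rewrite ty.
  by apply: iloc => m mM'; apply: yx'; rewrite mem_cat map_f ?orbT.
(* Inside [Sigma], the cylinder of [s k.+1] lies in that of [s k] and avoids the kernel of [t^k]; a
   common point is killed by no iterate. *)
pose s := fix s k : Sigma * seq G :=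
  if k is k'.+1 then next (k', s k') else (SigSub (mem_set Ssub.1), [::]).
pose F k := fiber id Sigma (s k).2 (set_val (s k).1).
have Fdecr m n : (m <= n)%N -> F n `<=` F m.
  move=> /subnKC <-; elim: (n - m)%N => [|k IH]; first by rewrite addn0.
  rewrite addnS => y [Sy ys]; apply: IH; split=> // g gs.
  have [sub eqs _] := nextP ((m + k)%N, s (m + k)%N).
  by rewrite -(eqs g gs); apply: ys; exact: sub.
have [||||x xP] := @linear_compactness K G A nat F.
- move=> k; apply: (fiber_affine (lca_id G A)); first exact: subspace_affine.
  by exists (set_val (s k).1); split=> //; exact: set_valP.
- by move=> k; exact: (fiber_closed (lca_id G A)).
- move=> m n; exists (maxn m n) => y Fy.
  by split; apply: Fdecr Fy; rewrite ?leq_maxl ?leq_maxr.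
- exact: 0%N.
have [Sx _] := xP 0%N; have [n tx] := nilt x Sx.
have [_ _ nz] := nextP (n, s n); have [_ xs] := xP n.+1.
exact: nz Sx xs tx.
Qed.

(** * Vanishing of a finite-dimensional limit set *)

Section FiniteDimensional.
Variable M0 : seq G.
Hypothesis Smask : forall C, saturated M0 C -> forall x, Sigma x ->
  Sigma (mask C x).
Hypothesis Gi : infinite_set [set: G].
Hypothesis Smix : topologically_mixing Sigma.

Lemma Omega_mask C x : saturated (M0 ++ M) C -> Omega x -> Omega (mask C x).
Proof.
move=> satC Ox n; have [y Sy <-] := Ox n; exists (mask C y).
  by apply: Smask => // g m mM; apply: satC; rewrite mem_cat mM.
elim: n {Ox} => //= n ->; apply: (lca_mask _ tM) => g m mM.
by apply: satC; rewrite mem_cat mM orbT.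
Qed.

Variable E : seq G.
Hypothesis E1 : 1%g \in E.
Hypothesis OE : forall x, Omega x -> {in E, x =1 0} -> x = 0.

Lemma Omega_inj x y : Omega x -> Omega y -> {in E, x =1 y} -> x = y.
Proof.
move=> Ox Oy xy; apply/eqP; rewrite -subr_eq0 addrC -scaleN1r; apply/eqP/OE.
  exact: Omega_subspace.2.
move=> g gE; transitivity (-1 *: y g + x g) => //.
by rewrite xy // scaleN1r addNr.
Qed.

(* Otherwise some nonzero limit configuration could be supported off the
   coset hull of the determining window [E]. *)
Lemma saturated_window_full w C : Omega w -> w <> 0 ->
  saturated (M0 ++ M) C -> {in E, forall g, C g} -> forall g, C g.
Proof.
move=> Ow w0 satC CE g; apply: contrapT => nCg.
apply: w0; apply/funext => h.
have satC' : saturated (M0 ++ M) (~` C).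
  by move=> k m mM; rewrite /setC /=; have := satC k m mM; tauto.
have : mask (~` C) (shift (g * h^-1)%g w) = 0.
  apply: OE; first by apply: Omega_mask => //; exact: Omega_shift.
  by move=> k kE; rewrite /mask asboolF // => /(_ (CE k kE)).
move=> /(congr1 (@^~ g)).
by rewrite /mask asboolT // /shift invgM invgK -mulgA mulVg mulg1.
Qed.

(** Around each [g], [x] looks like a unique [v g] in [Omega]. Overlapping windows make [v g] and
    [v (g * s)] translates of each other, and the cells where [v g] is the translate of [v 1] fill
    [G]; so [x] is [v 1]. *)
Lemma iterate_eq_Omega w : Omega w -> w <> 0 ->
  exists n, iterate n `<=` Omega.
Proof.
(* Including [E] among the steps in [L] makes each cell of [E] reachable from [1] in one step. *)
move=> Ow w0; pose L := (M0 ++ M) ++ E.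
pose E' := E ++ [seq (s * e)%g | s <- L, e <- E].
have [n nP] := limit_window E'; exists n => x Xx.
have /choice[v vP] g : exists v,
    Omega v /\ forall e, e \in E' -> v e = x (g * e)%g.
  have [v [Ov vx]] := nP _ (iterate_shift g^-1%g Xx).
  exists v; split=> // e eE'.
  by rewrite (vx e eE') /shift invgK.
have vM g s : s \in L -> v (g * s)%g = shift s^-1%g (v g).
  move=> sL; apply: Omega_inj; first exact: (vP _).1.
    by apply: Omega_shift; exact: (vP _).1.
  move=> e eE; rewrite (vP _).2 ?mem_cat ?eE // /shift invgK (vP _).2 ?mulgA //.
  by rewrite mem_cat; apply/orP; right; apply/allpairsP; exists (s, e).
pose C : set G := [set g | v g = shift g^-1%g (v 1%g)].
have CM g s : s \in L -> C (g * s)%g <-> C g.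
  move=> sL; rewrite /C /= vM //.
  have -> : shift (g * s)^-1 (v 1%g) = shift s^-1 (shift g^-1 (v 1%g)).
    by apply/funext => h; rewrite /shift !invgK mulgA.
  split=> [/(congr1 (shift s))|->//].
  have shiftK y : shift s (shift s^-1 y) = y :> (G -> A).
    by apply/funext => h; rewrite /shift invgK mulVKg.
  by rewrite !shiftK.
have Cfull : forall g, C g.
  apply: (saturated_window_full Ow w0) => [g m mM|g gE].
    by apply: CM; rewrite mem_cat mM.
  rewrite -[g]mul1g CM ?mem_cat ?gE ?orbT // /C /=.
  by apply/funext => h; rewrite /shift invgK mul1g.
have -> : x = v 1%g; last exact: (vP _).1.
apply/funext => g; have := (vP g).2 1%g; rewrite mem_cat E1 mulg1 => <- //.
by rewrite Cfull /shift invgK mulg1.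
Qed.

(** Mixing gives [z = g v] in [Sigma] with [t^n z] equal to [w] on [E] and [t^n v] zero on [E]. As
    [t^n v] is in [Omega] it is zero, hence so is [t^n z], and [w] vanishes on [E]. *)
Lemma mixing_Omega0 w : Omega w -> w = 0.
Proof.
move=> Ow; apply: contrapT => w0.
have [n Xn] := iterate_eq_Omega Ow w0.
have [M' iM] := lca_iter n tM; have [_ ish _] := iM.
pose W y : set (prodiscrete G A) := iter n t @^-1` cylinder E y.
have oW y : relatively_open (Sigma : set (prodiscrete G A)) (W y `&` Sigma).
  by exists (W y) => //; exact: lca_preimage_open iM.
have [||F Ffin FP] := Smix (oW w) (oW 0).
- by have [x Sx xw] := Ow n; exists x; split=> //; rewrite /W /preimage /= xw.
- exists 0; split; last exact: Ssub.1.
  by move=> g gE; rewrite (lca_eq0 iM).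
have [g nFg] : exists g, ~ F g.
  apply: contrapT => nF; apply: Gi; rewrite (_ : [set: G] = F) //.
  by apply/seteqP; split=> // g _; apply: contrapT => Fg; apply: nF; exists g.
have [z [[Wz _] [v [Wv Sv] vz]]] := FP g nFg; rewrite -vz in Wz.
have tv0 : iter n t v = 0 by apply: OE => //; apply: Xn; exists v.
by apply: w0; apply: OE => // h hE; rewrite -(Wz h hE) ish tv0.
Qed.

End FiniteDimensional.
End LimitSet.

(** * The cycle of implications *)

Lemma iter_restriction (T : Type) (S : set T) (tau : S -> S) (t : T -> T) :
  (forall x, set_val (tau x) = t (set_val x)) ->
  forall n x, set_val (iter n tau x) = iter n t (set_val x).
Proof. by move=> tauE; elim=> //= n IH x; rewrite tauE IH. Qed.

Theorem corollary1p10 (G : groupType) (K : fieldType) (A : vectType K)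
    (Sigma : set (G -> A)) (tau : Sigma -> Sigma) :
  infinite_set [set: G] ->
  linear_sofic Sigma ->
  topologically_mixing Sigma ->
  linear_CA_on tau ->
  [<-> nilpotent_map tau;
       pointwise_nilpotent_map tau;
       exists n0 : nat, finite_dimensional (iter_image tau n0);
       finite_dimensional (limit_set tau);
       limit_set tau = [set 0] ].
Proof.
move=> Gi Ssofic Smix [t /linear_CA_lca[M tM] tauE].
have [[Scl Ssh Ssub] _] := Ssofic.
have {}Scl := prodiscrete_closed_window Scl.
have tS x : Sigma x -> Sigma (t x).
  by move=> Sx; have := tauE (SigSub (mem_set Sx)) => /= <-; exact: set_valP.
have tauX := iter_restriction tauE.
have imE n : iter_image tau n = iterate Sigma t n.
  apply/seteqP; split=> _ [x Sx <-].
    by rewrite tauX; exists (set_val x) => //; exact: set_valP.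
  by exists (SigSub (mem_set Sx)); rewrite ?tauX.
have limE : limit_set tau = Omega Sigma t.
  apply/seteqP; split=> x.
    move=> xP n; have := xP n.+1 isT; rewrite imE.
    by apply: iterate_decr.
  by move=> xP n _; rewrite imE.
have O0 : Omega Sigma t 0 := (Omega_subspace Ssub tM).1.
have z0 : Sigma 0 := Ssub.1.
pose o : Sigma := SigSub (mem_set z0).
have tau0 n : iter n tau o = o.
  have [M' iM] := lca_iter n tM.
  by apply: val_inj; rewrite [LHS]tauX (lca_eq0 iM).
tfae.
- move=> [c [n [n1 cP]]]; exists c => x; exists n => // m /subnKC <-.
  by rewrite iterD cP.
- move=> [c cP].
  have -> : (fun n => finite_dimensional (iter_image tau n)) =
      (fun n => finite_dimensional (iterate Sigma t n)).
    by apply/funext => n; rewrite imE.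
  apply: (pointwise_nilpotent_finite_dimensional Scl Ssub tM) => x Sx.
  (* The zero configuration [o] is fixed by [tau], so the common eventual value [c] is [o]. *)
  have [n _ nP] := cP (SigSub (mem_set Sx)); have [m _ mP] := cP o.
  exists n; have := congr1 set_val (nP n (leqnn n)); rewrite tauX => ->.
  by rewrite -(mP m (leqnn m)) tau0.
- move=> [n]; rewrite imE limE => Xfd.
  apply: finite_dimensional_subspace Xfd _ _; first exact: Omega_subspace tM.
  by move=> x; exact.
- rewrite limE => Ofd; apply/seteqP; split=> [w Ow|_ ->//].
  have [M0 Smask] := sofic_mask Ssofic.
  have [E EP] := finite_dimensional_window Ofd.
  (* The cell [1] is added to the window because [x g] is read off as the value of [v g] at [1]. *)
  apply: (@mixing_Omega0 K G A Sigma t M _ _ _ _ _ M0 _ _ _ (1%g :: E)) => //.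
    exact: mem_head.
  by move=> x Ox xE; apply: EP => // g gE; apply: xE; rewrite inE gE orbT.
- rewrite limE => Oe.
  have [n nP] := Omega0_nilpotent Scl Ssh Ssub tM tS Oe.
  exists o, n.+1; split=> // x; apply: val_inj; rewrite [LHS]tauX nP //.
  exact: set_valP.
Qed.
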